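(* Let $\{R_k\}_{k\in N_T}$ be real symmetric positive definite $n\times n$ matrices and $\{A_k\}_{k\in N_{T-1}},\{C_k\}_{k\in N_{T-1}}$ real $n\times n$ matrices. For all integers $0\le k\le l\le T$, $$\phi_{l,k}'(I_{2^{l-k}}\otimes R_l)\phi_{l,k}=R_k^{\frac12}\bar\phi_{l,k}'\bar\phi_{l,k}R_k^{\frac12}.$$
   Context: $T\ge1$ is an integer, $N_T:=\{0,1,\dots,T\}$; $M'$ is the transpose, $\otimes$ the Kronecker product, $I_m$ the $m\times m$ identity, and $R^{1/2}$ the symmetric positive definite square root of $R$. Set $\bar A_k=R_{k+1}^{1/2}A_kR_k^{-1/2}$ and $\bar C_k=R_{k+1}^{1/2}C_kR_k^{-1/2}$ for $k\in N_{T-1}$. Define $\phi_{k,k}=\bar\phi_{k,k}=I_n$ and, for $l>k$, $$\phi_{l,k}=\begin{bmatrix}(I_{2^{l-k-1}}\otimes A_{l-1})\phi_{l-1,k}\\ (I_{2^{l-k-1}}\otimes C_{l-1})\phi_{l-1,k}\end{bmatrix},\qquad \bar\phi_{l,k}=\begin{bmatrix}(I_{2^{l-k-1}}\otimes \bar A_{l-1})\bar\phi_{l-1,k}\\ (I_{2^{l-k-1}}\otimes \bar C_{l-1})\bar\phi_{l-1,k}\end{bmatrix}.$$ *)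

(* Defs.v *)
From mathcomp Require Import all_boot all_order all_algebra.
From mathcomp Require Import boolp classical_sets reals.
From mathcomp.real_closed Require Import mxtens.

Set Implicit Arguments.
Unset Strict Implicit.
Unset Printing Implicit Defensive.

Import Order.TTheory GRing.Theory Num.Theory.
Local Open Scope ring_scope.

Definition spd (K : realType) (n : nat) (M : 'M[K]_n) : Prop :=
  M \is symmetricmx /\ forall x : 'cV[K]_n, x != 0 -> 0 < (x^T *m M *m x) 0 0.

(* The symmetric positive definite square root, which exists and is unique when
   [M] is symmetric positive definite; the default value is 0 otherwise. *)
Definition sqrtmx (K : realType) (n : nat) (M : 'M[K]_n) : 'M[K]_n :=
  xget 0 (fun S : 'M[K]_n => spd S /\ S *m S = M).

Definition barmx (K : realType) (n : nat) (R A : nat -> 'M[K]_n) (k : nat) :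
    'M[K]_n :=
  sqrtmx (R k.+1) *m A k *m invmx (sqrtmx (R k)).

Fact phi_dim0 (n : nat) : (n = 2 ^ 0 * n)%N.
Proof. by rewrite expn0 mul1n. Qed.

Fact phi_dimS (d n : nat) : (2 ^ d * n + 2 ^ d * n = 2 ^ d.+1 * n)%N.
Proof. by rewrite expnS mul2n -addnn mulnDl. Qed.

(* [phi_steps A C k d] is phi_{k+d,k}; with l = k+d+1, the matrices entering at
   step [d.+1] are those of index l-1 = k+d, and 2^(l-k-1) = 2^d. The casts only
   identify equal row dimensions. *)
Fixpoint phi_steps (K : realType) (n : nat) (A C : nat -> 'M[K]_n)
    (k d : nat) : 'M[K]_(2 ^ d * n, n) :=
  if d is d'.+1 then
    castmx (phi_dimS d' n, erefl n)
      (col_mx (((1%:M : 'M[K]_(2 ^ d')) *t A (k + d')%N) *m phi_steps A C k d')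
              (((1%:M : 'M[K]_(2 ^ d')) *t C (k + d')%N) *m phi_steps A C k d'))
  else castmx (phi_dim0 n, erefl n) 1%:M.

(* phi_{l,k}, meaningful for k <= l. *)
Definition phi (K : realType) (n : nat) (A C : nat -> 'M[K]_n) (l k : nat) :
    'M[K]_(2 ^ (l - k) * n, n) :=
  phi_steps A C k (l - k).

Definition phibar (K : realType) (n : nat) (R A C : nat -> 'M[K]_n)
    (l k : nat) : 'M[K]_(2 ^ (l - k) * n, n) :=
  phi (barmx R A) (barmx R C) l k.

(* Main.v *)
Require Import Defs.
From mathcomp Require Import all_boot all_order all_algebra.
From mathcomp Require Import classical_sets reals.
From mathcomp.real_closed Require Import mxtens complex.

Set Implicit Arguments.
Unset Strict Implicit.
Unset Printing Implicit Defensive.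

Import Order.TTheory GRing.Theory Num.Theory.
Local Open Scope ring_scope.

(** Write [S_i] for the square root of [R_i]. The identity is the squared form of
    the intertwining relation
      [(I *t S_l) *m phi_{l,k} = phibar_{l,k} *m S_k],
    which is [phi_steps_conj]: multiplying each side on the left by its own
    transpose gives the result, because [S_l] and [S_k] are symmetric and
    [S_l *m S_l = R_l]. The relation itself follows by induction on [l - k]: the
    barred matrices are conjugated so that [barmx R A i *m S_i = S_{i+1} *m A_i],
    hence the square roots introduced at consecutive steps telescope. The only
    structural fact used is that [I *t S] is block diagonal, so that it acts
    separately on the two stacked halves of [phi_{l+1,k}] ([tens1mx_mul_col]).

    All this presupposes that a symmetric positive definite [M] has a symmetric
    positive definite square root. Over the complex
    extension [K[i]], the spectral theorem diagonalizes [M] with real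
    eigenvalues, so a real polynomial that vanishes at the eigenvalues of [M]
    annihilates [M] ([symmetric_spectrum]). If a real polynomial [p] interpolates
    the fourth root on these positive eigenvalues, then [N = p(M)] is a real
    symmetric matrix with [N ^ 4 = M], and [N ^ 2] is the required root: its
    quadratic form is the squared norm of [N x] ([spd_sqrt_exists]). Working with
    polynomials in [M] keeps the root real although the diagonalization is
    complex. *)

(** * Polynomials in a symmetric matrix *)

Lemma poly_interpolation (F : fieldType) (s : seq F) (f : F -> F) :
  exists p : {poly F}, {in s, forall x, p.[x] = f x}.
Proof.
elim: s => [|y s [p IHp]]; first by exists 0.
have [ys|yNs] := boolP (y \in s).
  by exists p => x; rewrite inE => /predU1P[->|]; exact: IHp.
pose q := \prod_(z <- s) ('X - z%:P).
have qy : q.[y] != 0 by rewrite -[_ == 0]/(root q y) root_prod_XsubC.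
(* Adding a multiple of [q] leaves the values on [s] unchanged. *)
exists (p + ((f y - p.[y]) / q.[y])%:P * q) => x.
rewrite inE !hornerE => /predU1P[->|xs]; first by rewrite divfK // addrC subrK.
have /eqP -> : q.[x] == 0 by rewrite -[_ == 0]/(root q x) root_prod_XsubC.
by rewrite mulr0 addr0 IHp.
Qed.

Lemma trmx_horner_mx (F : comNzRingType) (n : nat) (M : 'M[F]_n.+1)
    (p : {poly F}) : (horner_mx M p)^T = horner_mx M^T p.
Proof.
elim/poly_ind: p => [|p c IHp]; first by rewrite !rmorph0 trmx0.
rewrite !(rmorphD, rmorphM) /= !horner_mx_X !horner_mx_C.
rewrite linearD /= tr_scalar_mx -[_ * M]/(_ *m M) trmx_mul IHp.
by congr (_ + _); exact/esym/comm_horner_mx.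
Qed.

Lemma symmetricmxP (F : fieldType) (n : nat) (M : 'M[F]_n) :
  reflect (M^T = M) (M \is symmetricmx).
Proof.
rewrite qualifE /= expr0 scale1r map_mx_id //.
by apply: (iffP eqP) => [<-|->].
Qed.

(** A symmetric matrix has enough real eigenvalues to be diagonalizable, in the
    form in which functional calculus uses it: two real polynomials that agree
    on [s] take the same value at [M]. The eigenvalues come from the unitary
    diagonalization over [K[i]], and both conclusions descend to [K]: the first
    because the complexified characteristic polynomial has real coefficients,
    the second because complexifying matrices is injective. *)
Lemma symmetric_spectrum (K : rcfType) (n : nat) (M : 'M[K]_n.+1) :
  M^T = M ->
  exists2 s : seq K, {in s, forall x, eigenvalue M x} &
    forall p : {poly K}, {in s, forall x, root p x} -> horner_mx M p = 0.
Proof.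
move=> symM; pose toC : {rmorphism K -> K[i]} := real_complex K.
pose MC := map_mx toC M.
have hermMC : MC \is hermsymmx.
  apply: realsym_hermsym.
    by apply/symmetricmxP; rewrite /MC map_trmx symM.
  by apply/mxOverP => i j; rewrite mxE complex_real.
have /orthomx_spectralP := hermitian_normalmx hermMC.
set P := spectralmx MC; set D := spectral_diag MC => MCE.
have Punit : P \in unitmx := spectral_unit MC.
have DE i : D 0 i = toC (complex.Re (D 0 i)).
  rewrite [RHS]RRe_real //.
  exact: (mxOverP (hermitian_spectral_diag_real hermMC)).
exists [seq complex.Re (D 0 i) | i : 'I_n.+1] => [x /mapP[i _ ->]|p ps].
  rewrite eigenvalue_root_char -(fmorph_root toC).
  rewrite -DE map_char_poly -eigenvalue_root_char; apply/eigenvalueP.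
  (* From [P *m MC = diag_mx D *m P], the rows of [P] are eigenvectors. *)
  exists (row i P); last first.
    apply/eqP => /(congr1 (mulmx^~ (invmx P))).
    rewrite -row_mul mulmxV // mul0mx => /rowP/(_ i)/eqP.
    by rewrite !mxE eqxx oner_eq0.
  rewrite -row_mul -[map_mx _ M]/MC {1}MCE !mulmxA mulmxV // mul1mx mul_diag_mx.
  by apply/rowP => j; rewrite !mxE.
apply: (map_mx_inj (f := toC)); rewrite map_horner_mx -/MC MCE.
rewrite horner_mx_uconjC // horner_mx_diag map_mx0.
suff -> : map_mx (horner (map_poly toC p)) D = 0.
  by rewrite raddf0 mulmx0 mul0mx.
apply/rowP => i; rewrite !mxE DE horner_map.
have /ps/rootP -> :
    complex.Re (D 0 i) \in [seq complex.Re (D 0 j) | j : 'I_n.+1].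
  by apply/mapP; exists i => //; rewrite mem_enum.
by rewrite rmorph0.
Qed.

(** * Positive definite matrices and their square roots *)

Lemma dotmx_gt0 (K : realDomainType) (n : nat) (x : 'cV[K]_n) :
  x != 0 -> 0 < (x^T *m x) 0 0.
Proof.
move=> /cV0Pn[i xi]; rewrite mxE (bigD1 i) //= ltr_pwDl //.
  by rewrite mxE -expr2 exprn_even_gt0.
by apply: sumr_ge0 => j _; rewrite mxE -expr2 sqr_ge0.
Qed.

Lemma spd_eigenvalue_gt0 (K : realType) (n : nat) (M : 'M[K]_n) (a : K) :
  spd M -> eigenvalue M a -> 0 < a.
Proof.
move=> [_ posM] /eigenvalueP[v vM v0].
have v0T : v^T != 0 by rewrite trmx_eq0.
have := posM _ v0T; rewrite trmxK vM -scalemxAl mxE.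
by rewrite pmulr_lgt0 // -{1}[v]trmxK dotmx_gt0.
Qed.

(** The square root is built as the square of a symmetric fourth root [N] of
    [M], so that its positivity is visible over [K]: [x^T *m (N *m N) *m x] is
    the squared norm of [N *m x], and [N *m x = 0] would force [M *m x = 0]. *)
Lemma spd_sqrt_exists (K : realType) (n : nat) (M : 'M[K]_n) :
  spd M -> exists S : 'M[K]_n, spd S /\ S *m S = M.
Proof.
case: n M => [|n] M spdM; first by exists M; split=> //; rewrite !thinmx0.
have [/symmetricmxP symM posM] := spdM.
have [s s_eig s_ann] := symmetric_spectrum symM.
have [p pE] := poly_interpolation s (fun x => Num.sqrt (Num.sqrt x)).
pose N := horner_mx M p.
have symN : N^T = N by rewrite trmx_horner_mx symM.
have N4 : (N *m N) *m (N *m N) = M.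
  apply/eqP; rewrite -subr_eq0; apply/eqP.
  transitivity (horner_mx M (p * p * (p * p) - 'X)).
    by rewrite rmorphB !rmorphM /= horner_mx_X.
  apply: s_ann => x xs; rewrite rootE hornerD hornerN !hornerM hornerX.
  rewrite pE // -!expr2.
  have x0 : 0 <= x := ltW (spd_eigenvalue_gt0 spdM (s_eig x xs)).
  by rewrite !sqr_sqrtr ?sqrtr_ge0 // subrr.
exists (N *m N); split=> //; split=> [|x x0].
  by apply/symmetricmxP; rewrite trmx_mul symN.
rewrite mulmxA -{1}symN -trmx_mul -mulmxA dotmx_gt0 //.
apply: contraTneq (posM x x0) => Nx0.
by rewrite -N4 -!mulmxA Nx0 !mulmx0 mxE ltxx.
Qed.

Lemma sqrtmxP (K : realType) (n : nat) (M : 'M[K]_n) :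
  spd M -> spd (sqrtmx M) /\ sqrtmx M *m sqrtmx M = M.
Proof. by move=> /spd_sqrt_exists exS; exact: (xgetPex 0 exS). Qed.

Lemma spd_unitmx (K : realType) (n : nat) (M : 'M[K]_n) :
  spd M -> M \in unitmx.
Proof.
move=> [_ posM]; rewrite -unitmx_tr -row_free_unit -kermx_eq0.
apply/rowV0P => v /sub_kermxP vM; apply/eqP/negP => /negP v0.
have vT0 : v^T != 0 by rewrite trmx_eq0.
have := posM _ vT0.
by rewrite -mulmxA -[M *m _]trmxK trmx_mul trmxK vM trmx0 mulmx0 mxE ltxx.
Qed.

(** * Kronecker products with an identity matrix *)

Lemma tens_col_block (K : pzRingType) (m1 m2 n p q : nat)
    (A : 'M[K]_(m1, n)) (B : 'M[K]_(m2, n)) (S : 'M[K]_(p, q))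
    (e : (m1 * p + m2 * p = (m1 + m2) * p)%N) :
  col_mx A B *t S = castmx (e, erefl) (col_mx (A *t S) (B *t S)).
Proof.
apply/matrixP => i j; case: (mxtens_indexP i) => i0 i1.
case: (mxtens_indexP j) => j0 j1; rewrite tensmxE castmxE /= cast_ord_id.
rewrite -(splitK i0); case: (split i0) => k /=.
  have -> : cast_ord (esym e) (mxtens_index (lshift m2 k, i1))
     = lshift (m2 * p) (mxtens_index (k, i1)) by apply: val_inj.
  by rewrite !col_mxEu tensmxE.
have -> : cast_ord (esym e) (mxtens_index (rshift m1 k, i1))
   = rshift (m1 * p) (mxtens_index (k, i1)).
  by apply: val_inj; rewrite /= mulnDl addnA.
by rewrite !col_mxEd tensmxE.
Qed.

(** [I_{2m} *t S] is block diagonal with two blocks [I_m *t S]. The dimensions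
    [m'] and [m + m] are only propositionally equal so that the lemma applies
    with [m = 2 ^ d] and [m' = 2 ^ d.+1]. *)
Lemma tens1mx_mul_col (K : comPzRingType) (m m' n p : nat) (S : 'M[K]_n)
    (U V : 'M[K]_(m * n, p)) (e : (m * n + m * n = m' * n)%N) :
  (m + m = m')%N ->
  ((1%:M : 'M[K]_m') *t S) *m castmx (e, erefl) (col_mx U V)
  = castmx (e, erefl) (col_mx (((1%:M : 'M[K]_m) *t S) *m U)
                              (((1%:M : 'M[K]_m) *t S) *m V)).
Proof.
move=> em; case: m' / em e => e.
have tens_row A B : row_mx A B *t S
   = castmx (erefl, e) (row_mx (A *t S) (B *t S)) :> 'M[K]_(m * n, _).
  by apply: trmx_inj; rewrite trmx_tens trmx_cast !tr_row_mx tens_col_block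
                              -!trmx_tens.
rewrite scalar_mx_block block_mxEv tens_col_block !tens_row !tens0mx.
case: _ / e {tens_row}; rewrite !castmx_id mul_col_mx !mul_row_col.
by rewrite !mul0mx addr0 add0r.
Qed.

(** * The intertwining relation *)

(** Conjugating the coefficients by the square roots amounts to the change of
    variable [x_i |-> S_i x_i] in the recursion, where [S_i] is the square root
    of [R_i]. Iterating, only the two end roots remain. *)
Lemma phi_steps_conj (K : realType) (T n : nat) (R A C : nat -> 'M[K]_n)
    (k d : nat) :
  (forall i, (i <= T)%N -> spd (R i)) -> (k + d <= T)%N ->
  ((1%:M : 'M[K]_(2 ^ d)) *t sqrtmx (R (k + d)%N)) *m phi_steps A C k d
  = phi_steps (barmx R A) (barmx R C) k d *m sqrtmx (R k).
Proof.
move=> spdR; elim: d => [|d IHd] kdT.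
  have -> : (1%:M : 'M[K]_(2 ^ 0)) *t sqrtmx (R (k + 0)%N)
     = castmx (phi_dim0 n, phi_dim0 n) (sqrtmx (R k)).
    rewrite addn0 (@tens_scalar_mx _ n n 1) scale1r.
    by congr (castmx (_, _) _); exact: eq_irrelevance.
  rewrite /=; case: _ / (phi_dim0 n).
  by rewrite !castmx_id mulmx1 mul1mx.
have kd : (k + d <= T)%N by rewrite (leq_trans _ kdT) // leq_add2l.
(* The factor [invmx S_i] of [barmx R B i] cancels the [S_i] that the induction
   hypothesis moves to the left of [phi_steps]. *)
have step (B : nat -> 'M[K]_n) :
    (1%:M *t sqrtmx (R (k + d.+1)%N)) *m
      ((1%:M *t B (k + d)%N) *m phi_steps A C k d)
    = (1%:M *t barmx R B (k + d)%N) *m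
       (phi_steps (barmx R A) (barmx R C) k d *m sqrtmx (R k)).
  rewrite -IHd // !mulmxA !tensmx_mul !mul1mx /barmx -addnS mulmxKV //.
  by apply: spd_unitmx; have [] := sqrtmxP (spdR _ kd).
rewrite /= tens1mx_mul_col ?expnS ?mul2n ?addnn // !step !mulmxA -mul_col_mx.
rewrite -[sqrtmx (R k) in RHS](castmx_id (erefl, erefl)).
by rewrite castmx_mul castmx_id.
Qed.

Theorem lemma6 (K : realType) (T n : nat) (R A C : nat -> 'M[K]_n)
    (hT : (1 <= T)%N)
    (hR : forall k : nat, (k <= T)%N -> spd (R k))
    (l k : nat) (hkl : (k <= l)%N) (hlT : (l <= T)%N) :
  (phi A C l k)^T *m ((1%:M : 'M[K]_(2 ^ (l - k))) *t R l) *m phi A C l k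
  = sqrtmx (R k) *m (phibar R A C l k)^T *m phibar R A C l k *m sqrtmx (R k).
Proof.
have sym i : (i <= T)%N -> (sqrtmx (R i))^T = sqrtmx (R i).
  by move=> iT; apply/symmetricmxP; have [[]] := sqrtmxP (hR i iT).
have [_ <-] := sqrtmxP (hR l hlT).
have conj := @phi_steps_conj _ T n R A C k (l - k) hR.
rewrite subnKC // in conj; have {}conj := conj hlT.
rewrite -[1%:M](mul1mx 1%:M) -tensmx_mul -{1}(sym l hlT) -{1}trmx1 -trmx_tens.
rewrite !mulmxA -trmx_mul -mulmxA /phi conj.
by rewrite trmx_mul sym ?(leq_trans hkl) // !mulmxA.
Qed.
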